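(* Let $1\le K\le N$ be integers. An urn contains $N$ objects, of which $K$ are good and $N-K$ are bad, and objects are drawn one at a time, uniformly at random and without replacement. Let $X$ be the number of draws up to and including the first good object, let $P(k)=\Pr(X=k)$, and let $F(n)=\Pr(X\le n)$ be the cumulative distribution function of $X$. Then for every integer $n\ge 1$, $$F(n)=\sum_{k=1}^{n}P(k)=1-\mathrm{Fail}(n)=1-\frac{\binom{N-n}{K}}{\binom{N}{K}}.$$
   Context: For given integers $N,K$, the Fail-function is $\mathrm{Fail}(n)=\binom{N-n}{K}\big/\binom{N}{K}$, with the convention that $\binom{a}{K}=0$ whenever $a<K$ (including negative $a$), so that $\mathrm{Fail}(n)=0$ for $n>N-K$. The distribution of $X$ is given by $P(n)=\frac{\binom{N-n+1}{K}}{\binom{N}{K}}\cdot\frac{K}{N-n+1}$ for $n=1,\ldots,N-K+1$ and $P(n)=0$ for all other $n$. *)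

(* Defs.v *)
From HB Require Import structures.
From mathcomp Require Import all_boot all_order all_algebra.
From mathcomp Require Import all_classical all_reals all_analysis.
Set Implicit Arguments.
Unset Strict Implicit.
Unset Printing Implicit Defensive.
Import Order.TTheory GRing.Theory Num.Theory.
Local Open Scope classical_set_scope.
Local Open Scope ring_scope.

(* The binomial coefficient with integer upper argument and the convention
   that it is 0 when a < K, negative a included. *)
Definition binz (a : int) (K : nat) : nat :=
  if a is Posz m then 'C(m, K) else 0%N.

Definition Fail (R : realType) (N K n : nat) : R :=
  (binz (N%:Z - n%:Z) K)%:R / ('C(N, K))%:R.

Section Urn.
Context d (Omega : measurableType d) (R : realType) (P : probability Omega R).
Context (U : finType) (N : nat).

(* The event that the first [size s] objects drawn are, in order, those of s. *)
Definition drawn (D : Omega -> N.-tuple U) (s : seq U) : set Omega :=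
  [set w | take (size s) (D w) = s].

(* D w is the sequence of the N objects in the order in which they are drawn.
   Given that s has been drawn so far, the next object is uniformly distributed
   over the objects not in s; the conditional probability
     P (next draw is x | s) = (x \notin s) / #|objects not in s|
   is multiplied out, so that prefixes s of probability 0 are harmless. *)
Definition draws_without_replacement (D : Omega -> N.-tuple U) : Prop :=
  (forall s : seq U, measurable (drawn D s)) /\
  (forall (s : seq U) (x : U), (size s < N)%N ->
     P (drawn D (rcons s x)) =
     (P (drawn D s) *
       ((x \notin s)%:R / (#|[pred y | y \notin s]|)%:R)%:E)%E).

(* [find] counts from 0. *)
Definition first_good (G : {set U}) (t : N.-tuple U) : nat :=
  (find (fun x => x \in G) t).+1.

End Urn.

(* Main.v *)
Require Import Defs.
From HB Require Import structures.
From mathcomp Require Import all_boot all_order all_algebra.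
From mathcomp Require Import all_classical all_reals all_analysis.
From mathcomp Require Import ring.
Import Order.TTheory GRing.Theory Num.Theory.
Local Open Scope ring_scope.

(** For n <= N, the waiting time X exceeds n exactly when the first n objects
    drawn are all bad.  Under the sequential law of the draws, any given
    sequence of n distinct objects comes out first with probability 1 / N^_n,
    the reciprocal of a falling factorial, since its successive conditional
    probabilities are 1/N, 1/(N-1), and so on ([drawn_prob]).  There are
    (N-K)^_n repetition-free sequences of n bad objects, so
    Pr(X > n) = (N-K)^_n / N^_n ([prob_all_take]).  This quotient equals
    C(N-n, K) / C(N, K) = Fail(n) ([bin_ffact_swap]), and taking the complement
    gives F(n) = 1 - Fail(n).  For n > N both sides are 1.  That F(n) is the sum
    of the P(k) is additivity of the probability, as X takes positive integer
    values only ([cdf_sum_pmf]). *)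

(** Both sides count the ways of choosing K objects together with an ordered
    n-tuple of distinct objects disjoint from them. *)
Lemma bin_ffact_swap (N K n : nat) : (n <= N)%N -> (K <= N)%N ->
  ('C(N - n, K) * N ^_ n = 'C(N, K) * (N - K) ^_ n)%N.
Proof.
move=> nN KN; case: (leqP n (N - K)) => nNK; last first.
  by rewrite bin_small ?(ffact_small nNK) ?muln0// ltn_subCl.
have KNn : (K <= N - n)%N by rewrite leq_subCr.
apply/eqP; rewrite -(@eqn_pmul2r (K`! * (N - K - n)`! * (N - n)`!)); last first.
  by rewrite !muln_gt0 !fact_gt0.
apply/eqP; transitivity ((N - n)`! * N`!)%N.
  rewrite -[in RHS](bin_fact KNn) -[in RHS](ffact_fact nN).
  by rewrite (subnAC N K n); ring.
by rewrite -[in LHS](bin_fact KN) -[in LHS](ffact_fact nNK); ring.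
Qed.

Section draws.
Context {d : measure_display} {Omega : measurableType d} {R : realType}.
Context {P : probability Omega R} {U : finType} {N : nat}.
Context {D : Omega -> N.-tuple U}.
Hypothesis cardU : #|U| = N.
Hypothesis drawsD : draws_without_replacement P D.

Lemma drawn_prob (s : seq U) : (size s <= N)%N ->
  P (drawn D s) = ((uniq s)%:R / (N ^_ size s)%:R)%:E.
Proof.
have [_ stepD] := drawsD.
elim/last_ind: s => [_|s x IHs].
  rewrite /= ffactn0 divr1 -(probability_setT P); congr (P _).
  by apply/seteqP; split=> // w _; rewrite /drawn/= take0.
rewrite size_rcons => sN; rewrite stepD// IHs ?(ltnW sN)// -EFinM; congr EFin.
rewrite rcons_uniq ffactnSr; case: (boolP (uniq s)) => us; last first.
  by rewrite andbF !mul0r.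
have -> : #|[pred y | y \notin s]| = (N - size s)%N.
  by rewrite -cardU -(card_uniqP us) -(cardC (mem s)) addKn.
by rewrite andbT mul1r natrM invfM mulrCA.
Qed.

Lemma trivIset_drawn n :
  trivIset setT (fun s : n.-tuple U => drawn D s).
Proof.
apply/trivIsetP => s t _ _ st; apply/seteqP; split=> // w [].
rewrite /drawn/= !size_tuple => -> /val_inj /eqP.
by rewrite (negbTE st).
Qed.

Lemma all_take_bigcup (A : pred U) n : (n <= N)%N ->
  [set w | all A (take n (D w))]%classic =
  (\bigcup_(s in [set s : n.-tuple U | all A s]) drawn D s)%classic.
Proof.
move=> nN; apply/seteqP; split=> w /=.
  move=> aA; have sz : size (take n (D w)) == n by rewrite size_takel ?size_tuple.
  by exists (Tuple sz) => //; rewrite /drawn/= (eqP sz).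
by move=> [s /= aA]; rewrite /drawn/= size_tuple => ->.
Qed.

Lemma measurable_all_take (A : pred U) n : (n <= N)%N ->
  measurable [set w | all A (take n (D w))]%classic.
Proof.
move=> nN; rewrite all_take_bigcup//; apply: fin_bigcup_measurable => // s _.
by have [+ _] := drawsD; apply.
Qed.

(** Only the repetition-free sequences contribute, and all with the same
    weight, so the probability is their number divided by N^_n. *)
Lemma prob_all_take (A : pred U) n : (n <= N)%N ->
  P [set w | all A (take n (D w))]%classic =
  ((#|A| ^_ n)%:R / (N ^_ n)%:R)%:E.
Proof.
move=> nN; rewrite all_take_bigcup// measure_fin_bigcup//; last 3 first.
- exact: finite_finset.
- by apply: sub_trivIset (@trivIset_drawn n).
- by move=> s _; have [+ _] := drawsD; apply.
rewrite (@fsbigE _ _ _ _ _ [seq s : n.-tuple U <- index_enum _ | all A s])//; last 3 first.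
- by rewrite filter_uniq// index_enum_uniq.
- by move=> s /=; rewrite mem_filter => /andP[].
- by move=> s /= As; rewrite mem_filter As mem_index_enum.
rewrite big_filter_cond.
rewrite (eq_bigr (fun s : n.-tuple U => ((uniq s)%:R / (N ^_ n)%:R)%:E)); last first.
  by move=> s _; rewrite -[X in (N ^_ X)%N](size_tuple s) -drawn_prob ?size_tuple.
rewrite sumEFin -mulr_suml -natr_sum -big_mkcondr sum1_card.
rewrite -card_uniq_tuples; congr ((_%:R / _)%:E); apply: eq_card => s.
rewrite [in RHS]inE unfold_in; congr (_ && _).
by case: (boolP (all A s)) => //= As; rewrite mem_set.
Qed.

End draws.

Lemma cdf_sum_pmf (d : measure_display) (Omega : measurableType d)
    (R : realType) (P : probability Omega R) (X : {RV P >-> R})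
    (T : Omega -> nat) (n : nat) :
  (forall w, X w = (T w).+1%:R) ->
  cdf X n%:R = (\sum_(1 <= k < n.+1) pmf X k%:R)%:E.
Proof.
move=> XT.
rewrite /cdf /distribution /pushforward.
elim: n => [|n IHn].
  transitivity (P set0); last by rewrite measure0 big_nil.
  congr (P _); apply/seteqP; split=> // w /=.
  by rewrite in_itv/= XT lern0.
rewrite big_nat_recr//= EFinD -IHn /pmf fineK ?fin_num_measure//.
rewrite -measureU//.
- congr (P _); apply/seteqP; split=> w /=; rewrite !in_itv/= XT ler_nat.
    rewrite leq_eqVlt => /predU1P[->|]; [by right|by left; rewrite ler_nat].
  by case=> [|/eqP]; rewrite ?ler_nat ?eqr_nat; [apply: leqW|move/eqP->].
- by rewrite -[X in measurable X]setTI; exact: measurable_funPT.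
- apply/seteqP; split=> // w [] /=; rewrite in_itv/= XT ler_nat => + /eqP.
  by rewrite eqr_nat => + /eqP Tn; rewrite Tn ltnn.
Qed.

(** The bound on n matters: if no object drawn is good, [first_good] is N+1
    although every prefix of t avoids G. *)
Lemma first_good_gt (U : finType) (N : nat) (G : {set U}) (t : N.-tuple U)
  (n : nat) : (n <= N)%N ->
  (n < first_good G t)%N = all (fun x => x \notin G) (take n t).
Proof.
move=> nN; rewrite /first_good ltnS leqNgt -has_take_leq ?size_tuple//.
by rewrite -all_predC.
Qed.

Theorem theorem2p4 (N K : nat) (hK : (1 <= K)%N) (hKN : (K <= N)%N)
  (U : finType) (hU : #|U| = N) (G : {set U}) (hG : #|G| = K)
  (R : realType) (d : measure_display) (Omega : measurableType d)
  (P : probability Omega R)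
  (D : Omega -> N.-tuple U) (hD : draws_without_replacement P D)
  (X : {RV P >-> R}) (hX : forall w : Omega, X w = (first_good G (D w))%:R)
  (n : nat) (hn : (1 <= n)%N) :
  [/\ cdf X n%:R = (\sum_(1 <= k < n.+1) pmf X k%:R)%:E,
      \sum_(1 <= k < n.+1) pmf X k%:R = 1 - Fail R N K n
    & 1 - Fail R N K n = 1 - (binz (N%:Z - n%:Z) K)%:R / ('C(N, K))%:R].
Proof.
have cdfE : cdf X n%:R = (\sum_(1 <= k < n.+1) pmf X k%:R)%:E.
  by apply: cdf_sum_pmf => w; rewrite hX.
have cardB : #|[pred x | x \notin G]| = (N - K)%N.
  by rewrite -hU -hG -(cardC (mem G)) addKn.
have tail m : (m <= N)%N ->
    P [set w | (first_good G (D w) <= m)%N]%classic = (1 - Fail R N K m)%:E.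
  move=> mN.
  have -> : [set w | (first_good G (D w) <= m)%N]%classic =
      (~` [set w | all (fun x => x \notin G) (take m (D w))])%classic.
    apply/seteqP; split=> w /=; rewrite -first_good_gt// ltnNge; first by move=> ->.
    by move/negP; rewrite negbK.
  rewrite probability_setC; last exact: measurable_all_take hD _ _ mN.
  rewrite (prob_all_take hU hD)// cardB /Fail subzn//= -EFinB; congr (1 - _)%:E.
  apply/eqP; rewrite eqr_div ?pnatr_eq0 -?lt0n ?ffact_gt0 ?bin_gt0//.
  by rewrite -!natrM eqr_nat bin_ffact_swap// mulnC.
suff cdfF : cdf X n%:R = (1 - Fail R N K n)%:E.
  by split=> //; apply: EFin_inj; rewrite -cdfE.
have -> : cdf X n%:R = P [set w | (first_good G (D w) <= n)%N]%classic.
  rewrite /cdf /distribution /pushforward; congr (P _).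
  by apply/seteqP; split=> w /=; rewrite in_itv/= hX ler_nat.
case: (leqP n N) => [/tail//|Nn].
(* Past N both sides keep the value they have at N: as there are only N draws,
   the default value N+1 of the waiting time, meaning no good object at all,
   is also at most n. *)
have -> : Fail R N K n = 0.
  rewrite /Fail; have : (N%:Z - n%:Z < 0)%R by rewrite subr_lt0 ltz_nat.
  by case: (N%:Z - n%:Z) => //= k _; rewrite mul0r.
rewrite subr0 -(probability_setT P); congr (P _); apply/seteqP; split=> // w _ /=.
by rewrite /first_good (leq_trans _ Nn)// ltnS -[leqRHS](size_tuple (D w)) find_size.
Qed.
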